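(* Let $C,D\subset\mathbb{P}^n$ be irreducible hypersurfaces not contained in $\Delta_{n-1}$. If $C\star D$ is a hypersurface, then $C$ and $D$ are binomial hypersurfaces of the form $$C=Z(\alpha_1X^{I_1}-\alpha_2X^{I_2})\quad\text{and}\quad D=Z(\beta_1X^{I_1}-\beta_2X^{I_2})$$ for the same pair of monomials $X^{I_1},X^{I_2}$. Moreover, $C\star D=Z(\alpha_1\beta_1X^{I_1}-\alpha_2\beta_2X^{I_2})$.
   Context: We work over $\mathbb{C}$. For points $p=[a_0:\cdots:a_n]$ and $q=[b_0:\cdots:b_n]$ of $\mathbb{P}^n$ with $a_ib_i\neq 0$ for some $i$, put $p\star q=[a_0b_0:\cdots:a_nb_n]$; if $a_ib_i=0$ for all $i$, then $p\star q$ is not defined. For varieties $V,W\subset\mathbb{P}^n$, the Hadamard product $V\star W$ is the Zariski closure of $\{p\star q: p\in V,\ q\in W,\ p\star q \text{ is defined}\}$. $\Delta_{n-1}\subset\mathbb{P}^n$ is the union of the coordinate hyperplanes $x_i=0$, $i=0,\dots,n$. For $I=(i_0,\dots,i_n)\in\mathbb{N}^{n+1}$, $X^I$ denotes the monomial $x_0^{i_0}\cdots x_n^{i_n}$. $Z(f)$ denotes the zero set of $f$ in $\mathbb{P}^n$. A binomial hypersurface is an irreducible hypersurface in $\mathbb{P}^n$ whose defining equation (generator of its homogeneous ideal) is of the form $\alpha_1X^{I_1}-\alpha_2X^{I_2}=0$, with $X^{I_1}\neq X^{I_2}$ of the same degree and $\alpha_1,\alpha_2\in\mathbb{C}$ nonzero.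 *)

(* Defs.v *)
From mathcomp Require Export all_boot all_order all_algebra.
From mathcomp Require Export complex.
From mathcomp Require Export classical_sets reals.
From mathcomp Require Export mpoly.

Set Implicit Arguments.
Unset Strict Implicit.
Unset Printing Implicit Defensive.

Import Order.TTheory GRing.Theory Num.Theory.
Local Open Scope ring_scope.
Local Open Scope classical_set_scope.

(* P^n over the complex numbers R[i]: the lines through 0 in R[i]^(n+1). *)
Definition proj_space (R : realType) (n : nat) : Type :=
  {L : {vspace 'rV[R[i]]_n.+1} | (\dim L)%VS == 1%N}.

(* p = [a_0 : ... : a_n] *)
Definition coords (R : realType) (n : nat)
    (p : proj_space R n) (a : 'rV[R[i]]_n.+1) : Prop :=
  a != 0 /\ sval p = <[a]>%VS.

Definition eval_at (R : realType) (n : nat)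
    (f : {mpoly R[i][n.+1]}) (a : 'rV[R[i]]_n.+1) : R[i] :=
  f.@[fun j => a 0 j].

(* f vanishes at p when it vanishes at every choice of homogeneous coordinates
   of p; for homogeneous f a single choice suffices. *)
Definition vanishes_at (R : realType) (n : nat)
    (f : {mpoly R[i][n.+1]}) (p : proj_space R n) : Prop :=
  forall a, coords p a -> eval_at f a = 0.

Definition zero_set (R : realType) (n : nat)
    (f : {mpoly R[i][n.+1]}) : set (proj_space R n) :=
  [set p | vanishes_at f p].

Definition zariski_closed (R : realType) (n : nat)
    (V : set (proj_space R n)) : Prop :=
  exists F : set {mpoly R[i][n.+1]},
    (forall f, F f -> exists d : nat, f \is d.-homog) /\
    V = [set p | forall f, F f -> vanishes_at f p].

Definition zariski_closure (R : realType) (n : nat)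
    (S : set (proj_space R n)) : set (proj_space R n) :=
  [set p | forall V, zariski_closed V -> S `<=` V -> V p].

Definition irreducible_set (R : realType) (n : nat)
    (V : set (proj_space R n)) : Prop :=
  V !=set0 /\
  forall A B, zariski_closed A -> zariski_closed B ->
    V = A `|` B -> V = A \/ V = B.

Definition hypersurface (R : realType) (n : nat)
    (V : set (proj_space R n)) : Prop :=
  exists (d : nat) (f : {mpoly R[i][n.+1]}),
    [/\ (0 < d)%N, f != 0, f \is d.-homog & V = zero_set f].

Definition irreducible_hypersurface (R : realType) (n : nat)
    (V : set (proj_space R n)) : Prop :=
  hypersurface V /\ irreducible_set V.

Definition vanishing_ideal (R : realType) (n : nat)
    (V : set (proj_space R n)) : set {mpoly R[i][n.+1]} :=
  [set f | forall p, V p -> vanishes_at f p].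

Definition principal_ideal (R : realType) (n : nat)
    (f : {mpoly R[i][n.+1]}) : set {mpoly R[i][n.+1]} :=
  [set g | exists h, g = h * f].

(* The union of the coordinate hyperplanes, written Delta_(n-1) for P^n. *)
Definition coord_hyperplanes (R : realType) (n : nat) : set (proj_space R n) :=
  [set p | exists j : 'I_n.+1, zero_set 'X_j p].

Arguments coord_hyperplanes : clear implicits.

Definition hadamard_row (R : realType) (n : nat)
    (a b : 'rV[R[i]]_n.+1) : 'rV[R[i]]_n.+1 :=
  \row_j (a 0 j * b 0 j).

(* "p * q is defined and equal to r"; since [coords r c] requires c != 0, no r
   qualifies when a_j b_j = 0 for all j. *)
Definition hadamard_point (R : realType) (n : nat)
    (p q r : proj_space R n) : Prop :=
  exists a b, [/\ coords p a, coords q b & coords r (hadamard_row a b)].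

Definition hadamard_product (R : realType) (n : nat)
    (V W : set (proj_space R n)) : set (proj_space R n) :=
  zariski_closure
    [set r | exists p q, [/\ V p, W q & hadamard_point p q r]].

Definition binomial (R : realType) (n : nat)
    (a1 a2 : R[i]) (I1 I2 : 'X_{1..n.+1}) : {mpoly R[i][n.+1]} :=
  a1 *: 'X_[I1] - a2 *: 'X_[I2].

Definition binomial_hypersurface_of (R : realType) (n : nat)
    (V : set (proj_space R n)) (a1 a2 : R[i]) (I1 I2 : 'X_{1..n.+1}) : Prop :=
  irreducible_hypersurface V /\
  [/\ a1 != 0, a2 != 0, I1 != I2, mdeg I1 = mdeg I2
    & vanishing_ideal V = principal_ideal (binomial a1 a2 I1 I2)].

(* Main.v *)
(* Let p, q be torus points of C. The translates p * D and q * D are irreducible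
   hypersurfaces contained in the hypersurface C * D, which is irreducible because
   C and D are; hence both are equal to it and q / p stabilises D. The ideal of D
   is therefore graded by the characters of its stabiliser. Two monomials with
   constant ratio on the torus points of D must have the same character, since
   otherwise a monomial would lie in the ideal; and monomials with the same
   character have constant ratio on C. By symmetry C and D have the same pairs of
   monomials X^m, X^m' with constant ratio, and each ideal is spanned by the
   corresponding binomials. As D is a hypersurface, its ideal contains no nonzero
   polynomial omitting a suitable variable x_j, so such a pair is determined up to
   a common factor by m_j - m'_j. The binomial of a pair with disjoint supports and
   minimal positive m_j - m'_j then divides all the others. *)

From HB Require Import structures.
Require Import Defs.
From mathcomp Require Import boolp zify ring.
Import Order.TTheory GRing.Theory Num.Theory.
Local Open Scope ring_scope.
Local Open Scope classical_set_scope.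

Set Implicit Arguments.
Unset Strict Implicit.
Unset Printing Implicit Defensive.

(** * Primes contracting to zero *)

Section ContractionInOneVariable.
Variables (A : idomainType) (P Q : {poly A} -> Prop).

Lemma min_size_exists (S : {poly A} -> Prop) :
  (exists2 f, S f & f != 0) ->
  exists f, [/\ S f, f != 0 &
    forall h, S h -> h != 0 -> (size f <= size h)%N].
Proof.
case=> f Sf f0.
pose T k := `[< exists h, [/\ S h, h != 0 & size h = k] >].
have exT : exists k, T k by exists (size f); apply/asboolP; exists f.
case: (ex_minnP exT) => k /asboolP[h [Sh h0 <-]] hmin.
exists h; split => // h' Sh' h'0; apply: hmin; apply/asboolP.
by exists h'.
Qed.

Hypotheses (PM : forall u v, P v -> P (u * v)).
Hypotheses (QB : forall u v, Q u -> Q v -> Q (u - v)).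
Hypotheses (QM : forall u v, Q v -> Q (u * v)).
Hypothesis (Pprime : forall u v, P (u * v) -> P u \/ P v).
Hypothesis (subPQ : forall u, P u -> Q u).
Hypothesis (Qcontr : forall c, Q c%:P -> c = 0).
Hypothesis (Pnz : exists2 f, P f & f != 0).

(* After inverting the nonzero constants, A[x] becomes a principal ideal
   domain, in which nonzero primes are maximal. *)
Lemma eq_prime_of_contraction0 u : Q u -> P u.
Proof.
have [f [Qf f0 fmin]] : exists f, [/\ Q f, f != 0 &
    forall h, Q h -> h != 0 -> (size f <= size h)%N].
  by apply: min_size_exists; case: Pnz => f Pf f0; exists f => //; apply: subPQ.
have [f2 [Pf2 f20 f2min]] := min_size_exists Pnz.
have szf : (1 < size f)%N.
  rewrite ltnNge; apply/negP => /size1_polyC fE.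
  by move: f0; rewrite fE (Qcontr (c := f`_0)) ?eqxx // -fE.
have lc0 k : lead_coef f ^+ k != 0 by rewrite expf_neq0 // lead_coef_eq0.
have dvd h : Q h -> exists k q, lead_coef f ^+ k *: h = q * f.
  move=> Qh; exists (scalp h f), (h %/ f).
  have E := Pdiv.Idomain.divp_eq h f.
  have Qr : Q (h %% f).
    have -> : h %% f = (lead_coef f ^+ scalp h f)%:P * h - h %/ f * f.
      by rewrite mul_polyC E addrC addKr.
    by apply: QB; apply: QM.
  suff r0 : h %% f = 0 by rewrite E r0 addr0.
  apply/eqP/negP => /negP r0; have := fmin _ Qr r0.
  by rewrite leqNgt ltn_modp f0.
(* [f] divides a constant multiple of [f2], so by primality the quotient or [f] is in [P]. As [f] is
   not constant, the quotient is shorter than [f2], against the minimality of [f2]. *)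
have Pf : P f.
  have [k [q E]] := dvd _ (subPQ Pf2).
  have := PM (lead_coef f ^+ k)%:P Pf2; rewrite mul_polyC E => /Pprime[Pq|//].
  have q0 : q != 0.
    apply: contraNneq f20 => q0; move/eqP: E.
    by rewrite q0 mul0r -mul_polyC mulf_eq0 polyC_eq0 (negPf (lc0 k)).
  have := f2min _ Pq q0; rewrite -(size_scale f2 (lc0 k)) E size_mul //.
  have : (0 < size q)%N by rewrite size_poly_gt0.
  by lia.
move=> Qu; have [k [q E]] := dvd _ Qu.
have := PM q Pf; rewrite -E -mul_polyC => /Pprime[/subPQ/Qcontr/eqP|//].
by rewrite (negPf (lc0 k)).
Qed.

End ContractionInOneVariable.

(** * Splitting off one variable *)

Section Points.
Variable K : numFieldType.

Lemma poly_eq0_of_nonzero_roots (p : {poly K}) :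
  (forall x, x != 0 -> p.[x] = 0) -> p = 0.
Proof.
move=> H; apply/eqP/negP => /negP p0.
(* The numbers 1, ..., [size p] are distinct and nonzero in characteristic 0, more roots than the
   degree allows. *)
suff : (size [seq i.+1%:R : K | i <- iota 0 (size p)] < size p)%N.
  by rewrite size_map size_iota ltnn.
apply: max_poly_roots => //.
  by apply/allP => _ /mapP[i _ ->]; rewrite /root H ?pnatr_eq0.
by rewrite map_inj_uniq ?iota_uniq // => i k /eqP; rewrite eqr_nat => /eqP[].
Qed.

Lemma mpoly_rmorph_ext n (S : comNzRingType) (phi psi : {rmorphism {mpoly K[n]} -> S}) :
  (forall c, phi c%:MP = psi c%:MP) -> (forall i, phi 'X_i = psi 'X_i) ->
  phi =1 psi.
Proof.
move=> HC HX f; rewrite (mpolyE f) !raddf_sum; apply: eq_bigr => m _ /=.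
rewrite -mul_mpolyC !rmorphM /= HC mpolyXE_id !rmorph_prod; congr (_ * _).
by apply: eq_bigr => i _; rewrite !rmorphXn /= HX.
Qed.

End Points.

Section SplitVariable.
Variables (K : fieldType) (n : nat) (j : 'I_n.+1).

(** x_j becomes the polynomial variable; [unlift j] renumbers the others. *)
Definition split_coord (i : 'I_n.+1) : {poly {mpoly K[n]}} :=
  if unlift j i is Some k then ('X_k)%:P else 'X.

Definition split_var (f : {mpoly K[n.+1]}) : {poly {mpoly K[n]}} :=
  mmap (polyC \o @mpolyC n K) split_coord f.

Definition lift_var (c : {mpoly K[n]}) : {mpoly K[n.+1]} :=
  mmap (@mpolyC n.+1 K) (fun k : 'I_n => 'X_(lift j k)) c.

Definition join_var (p : {poly {mpoly K[n]}}) : {mpoly K[n.+1]} :=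
  (map_poly lift_var p).['X_j].

HB.instance Definition _ := GRing.RMorphism.copy split_var
  (mmap (polyC \o @mpolyC n K) split_coord).
HB.instance Definition _ := GRing.RMorphism.copy lift_var
  (mmap (@mpolyC n.+1 K) (fun k : 'I_n => 'X_(lift j k))).
HB.instance Definition _ := GRing.RMorphism.copy join_var
  (horner_eval 'X_j \o map_poly lift_var).

End SplitVariable.

Section SplitVariableTheory.
Variables (K : numFieldType) (n : nat) (j : 'I_n.+1).

Lemma split_varK : cancel (@split_var K n j) (@join_var K n j).
Proof.
apply: (@mpoly_rmorph_ext _ _ _ (@join_var K n j \o @split_var K n j) idfun) => [c|i] /=.
  by rewrite /split_var mmapC /= /join_var map_polyC hornerC /= /lift_var mmapC.
rewrite /split_var mmapX mmap1U /split_coord /join_var; case: unliftP => [k ->|->].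
  by rewrite map_polyC hornerC /= /lift_var mmapX mmap1U.
by rewrite map_polyX hornerX.
Qed.

Lemma meval_split_var (f : {mpoly K[n.+1]}) a :
  f.@[a] = (map_poly (meval (a \o lift j)) (split_var j f)).[a j].
Proof.
apply: (@mpoly_rmorph_ext _ _ _ (meval a)
  (horner_eval (a j) \o map_poly (meval (a \o lift j)) \o @split_var K n j)) => [c|i] /=.
  by rewrite mevalC /split_var mmapC /= /horner_eval map_polyC hornerC /= mevalC.
rewrite mevalXU /horner_eval /split_var mmapX mmap1U /split_coord; case: unliftP => [k ->|->].
  by rewrite map_polyC hornerC /= mevalXU.
by rewrite map_polyX hornerX.
Qed.

Lemma join_varC c : join_var j c%:P = lift_var j c :> {mpoly K[n.+1]}.
Proof. by rewrite /join_var map_polyC hornerC. Qed.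

Lemma meval_lift_var (c : {mpoly K[n]}) a :
  (lift_var j c).@[a] = c.@[a \o lift j].
Proof.
apply: (@mpoly_rmorph_ext _ _ _ (meval a \o @lift_var K n j)
  (meval (a \o lift j))) => [d|i] /=; rewrite /lift_var.
  by rewrite mmapC !mevalC.
by rewrite mmapX mmap1U !mevalXU.
Qed.

Lemma mcoeff_lift_var (c : {mpoly K[n]}) (m : 'X_{1..n.+1}) :
  (0 < m j)%N -> (lift_var j c)@_m = 0.
Proof.
move=> mj; rewrite (mpolyE c) rmorph_sum /= raddf_sum big1 //= => k _.
rewrite -mul_mpolyC rmorphM /= {1}/lift_var mmapC mcoeffCM.
pose M := [multinom if unlift j i is Some l then k l else 0%N | i < n.+1].
have -> : lift_var j 'X_[k] = 'X_[M] :> {mpoly K[n.+1]}.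
  rewrite [LHS]mmapX /mmap1 [RHS]mpolyXE_id (bigD1_ord j) //=.
  rewrite mnmE unlift_none expr0 mul1r; apply: eq_bigr => i _.
  by rewrite mnmE liftK.
rewrite mcoeffX; case: eqP => [E|]; last by rewrite mulr0.
by move: mj; rewrite -E mnmE unlift_none.
Qed.

Lemma split_var_size_gt1 (f : {mpoly K[n.+1]}) (m : 'X_{1..n.+1}) :
  f@_m != 0 -> (0 < m j)%N -> (1 < size (split_var j f))%N.
Proof.
move=> fm mj; rewrite ltnNge; apply/negP => /size1_polyC E.
by move: fm; rewrite -(split_varK f) E join_varC mcoeff_lift_var ?eqxx.
Qed.

End SplitVariableTheory.

(** Induction on the number of variables: a point where the leading coefficient in x_0 is nonzero
    leaves a nonzero polynomial in one variable. *)
Lemma mpoly_nonzero_value (K : numFieldType) n (f : {mpoly K[n]}) :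
  f != 0 -> exists a, f.@[a] != 0.
Proof.
elim: n f => [|n IH] f f0.
  exists (fun=> 0); move: f0.
  have [c ->] : exists c, f = c%:MP.
    exists f@_0%MM; apply/mpolyP => m; rewrite mcoeffC.
    have -> : m = 0%MM by apply/mnmP => -[].
    by rewrite eqxx mulr1.
  by rewrite mpolyC_eq0 mevalC.
have g0 : split_var ord0 f != 0.
  by apply: contraNneq f0 => E; rewrite -(split_varK ord0 f) E rmorph0.
have /IH[a ha] : lead_coef (split_var ord0 f) != 0 by rewrite lead_coef_eq0.
set p := map_poly (meval a) (split_var ord0 f).
have p0 : p != 0.
  apply: contraNneq ha => E; rewrite /lead_coef.
  have := congr1 (fun q : {poly K} => q`_(size (split_var ord0 f)).-1) E.
  by rewrite /= coef_map coef0 => ->.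
have [x _ hx] : exists2 x, x != 0 & p.[x] != 0.
  apply: contrapT => H; move/eqP: p0; apply; apply: poly_eq0_of_nonzero_roots.
  by move=> x x0; apply/eqP/negP => /negP hx; apply: H; exists x.
exists (fun i => if unlift ord0 i is Some k then a k else x).
rewrite (meval_split_var ord0) unlift_none.
rewrite (_ : map_poly _ _ = p) //; apply/polyP => i; rewrite !coef_map.
by apply: meval_eq => k /=; rewrite liftK.
Qed.

(** * Torus weights *)

Section Weights.
Variables (K : fieldType) (n : nat).
Implicit Types (f u v : {mpoly K[n]}) (m : 'X_{1..n}) (t a : 'I_n -> K).

Definition mon t m : K := \prod_i t i ^+ m i.

Definition torus t : Prop := forall i, t i != 0.

Definition mulpt a t : 'I_n -> K := fun i => a i * t i.

Definition divpt a t : 'I_n -> K := fun i => a i / t i.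

Lemma monD t m1 m2 : mon t (m1 + m2)%MM = mon t m1 * mon t m2.
Proof. by rewrite /mon -big_split; apply: eq_bigr => i _; rewrite mnmDE exprD. Qed.

Lemma mon_neq0 t m : torus t -> mon t m != 0.
Proof. by move=> ht; apply/prodf_neq0 => i _; rewrite expf_neq0. Qed.

Lemma mon_mulpt a t m : mon (mulpt a t) m = mon a m * mon t m.
Proof. by rewrite /mon -big_split; apply: eq_bigr => i _; rewrite exprMn. Qed.

Lemma mon_divpt a t m : mon (divpt a t) m = mon a m / mon t m.
Proof. by rewrite /mon -prodf_div; apply: eq_bigr => i _; rewrite expr_div_n. Qed.

Lemma divptK a t : torus t -> mulpt t (divpt a t) =1 a.
Proof. by move=> ht i; rewrite /mulpt /divpt mulrC divfK. Qed.

(** Common form of the operators diagonal on monomials: torus substitutions and projections to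
    character components. *)
Definition mweight (w : 'X_{1..n} -> K) f : {mpoly K[n]} :=
  \sum_(m <- msupp f) (w m * f@_m) *: 'X_[m].

Lemma mcoeff_mweight w f m : (mweight w f)@_m = w m * f@_m.
Proof.
rewrite /mweight raddf_sum /=.
have [mf|mf] := boolP (m \in msupp f).
  rewrite (bigD1_seq m) //= mcoeffZ mcoeffX eqxx mulr1 big1 ?addr0 // => k km.
  by rewrite mcoeffZ mcoeffX (negPf km) mulr0.
rewrite (memN_msupp_eq0 mf) mulr0 big1_seq // => k /andP[_ kf].
rewrite mcoeffZ mcoeffX; case: eqP => [E|]; last by rewrite mulr0.
by rewrite -E kf in mf.
Qed.

Lemma meval_mon f a : f.@[a] = \sum_(m <- msupp f) f@_m * mon a m.
Proof. by rewrite mevalE. Qed.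

Definition scale_poly t f := mweight (mon t) f.

Lemma meval_scale_poly t f a : (scale_poly t f).@[a] = f.@[mulpt t a].
Proof.
rewrite [RHS]meval_mon /scale_poly /mweight raddf_sum /=; apply: eq_bigr => m _.
by rewrite mevalZ mevalX mon_mulpt mulrAC mulrA mulrC mulrA mulrC.
Qed.

Lemma msupp_mweight w f : {subset msupp (mweight w f) <= msupp f}.
Proof.
by move=> m; rewrite !mcoeff_msupp mcoeff_mweight; apply: contraNneq => ->; rewrite mulr0.
Qed.

Lemma exists_msupp (f : {mpoly K[n]}) : f != 0 -> exists m, m \in msupp f.
Proof.
by rewrite -msupp_eq0; case: (msupp f) => // m s _; exists m; rewrite inE eqxx.
Qed.

End Weights.

Section WeightComponents.
Variables (K : fieldType) (n : nat) (I : {mpoly K[n]} -> Prop).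
Hypothesis (IB : forall u v, I u -> I v -> I (u - v)).
Hypothesis (IZ : forall c u, I u -> I (c *: u)).

Definition stabilises (t : 'I_n -> K) : Prop :=
  forall f, I f -> I (scale_poly t f).

Definition same_character (m m' : 'X_{1..n}) : Prop :=
  forall t, stabilises t -> mon t m = mon t m'.

(** The isotypic part of [f] for the character that [m0] induces on the stabiliser of [I]. *)
Definition component (m0 : 'X_{1..n}) (f : {mpoly K[n]}) : {mpoly K[n]} :=
  mweight (fun m => `[< same_character m m0 >]%:R) f.

(* A character of the stabiliser separating two monomials of f provides a
   combination of f and one of its translates with smaller support. *)
Lemma component_stable m0 f : I f -> I (component m0 f).
Proof.
have [k] := ubnP (size (msupp f)); elim: k f => // k IH f szf If.
have [H|/existsNP[m1 /not_implyP[m1f /existsNP[t /not_implyP[st tm]]]]] :=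
    pselect (forall m, m \in msupp f -> same_character m m0).
  suff -> : component m0 f = f by [].
  apply/mpolyP => m; rewrite mcoeff_mweight.
  have [mf|/memN_msupp_eq0->] := boolP (m \in msupp f); last by rewrite mulr0.
  by rewrite (asboolT (H _ mf)) mul1r.
(* The weight kills [m1] and is a nonzero constant on the class of [m0], so the support shrinks
   while the component is only rescaled. *)
pose f' := mweight (fun m => mon t m - mon t m1) f.
have f'E : f' = scale_poly t f - mon t m1 *: f.
  by apply/mpolyP => m; rewrite mcoeffB mcoeffZ !mcoeff_mweight mulrBl.
have If' : I f' by rewrite f'E; apply: IB; [apply: st | apply: IZ].
have szf' : (size (msupp f') < k)%N.
  apply: leq_trans (_ : size (msupp f) <= k)%N => //.
  have : {subset m1 :: msupp f' <= msupp f}.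
    by move=> m; rewrite inE => /orP[/eqP->//|/msupp_mweight].
  move/uniq_leq_size; apply; rewrite /= msupp_uniq andbT mcoeff_msupp.
  by rewrite mcoeff_mweight subrr mul0r eqxx.
have := IH _ szf' If'.
have d0 : mon t m0 - mon t m1 != 0 by rewrite subr_eq0 eq_sym; apply/eqP.
have -> : component m0 f' = (mon t m0 - mon t m1) *: component m0 f.
  apply/mpolyP => m; rewrite mcoeffZ !mcoeff_mweight.
  by case: asboolP => [/(_ _ st) ->|_]; rewrite ?mul0r ?mul1r ?mulr0.
move/(IZ (mon t m0 - mon t m1)^-1).
by rewrite scalerA mulVf // scale1r.
Qed.

End WeightComponents.

(** * Monomials with constant ratio on a hypersurface *)

Section VanishingOnHypersurface.
Variables (K : numClosedFieldType) (n : nat).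
Implicit Types (f g h u v : {mpoly K[n.+1]}) (m : 'X_{1..n.+1}).
Implicit Types (a p q t : 'I_n.+1 -> K).

(* The zeros of g are taken in affine space, the origin included. *)
Definition vanishing_on_zeros g f : Prop :=
  forall a, g.@[a] = 0 -> f.@[a] = 0.

Definition prime_vanishing g : Prop := forall u v,
  vanishing_on_zeros g (u * v) -> vanishing_on_zeros g u \/ vanishing_on_zeros g v.

(** The cone over an irreducible hypersurface that meets the torus. Primality concerns the ideal of
    the zeros, so [g] may be a power of the reduced equation. *)
Definition torus_hypersurface g : Prop :=
  [/\ g != 0, exists2 d, (0 < d)%N & g \is d.-homog, prime_vanishing g
    & exists2 p, torus p & g.@[p] = 0].

Lemma vanishB g u v : vanishing_on_zeros g u -> vanishing_on_zeros g v ->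
  vanishing_on_zeros g (u - v).
Proof. by move=> hu hv a ga; rewrite mevalB hu // hv // subrr. Qed.

Lemma vanishZ g c u : vanishing_on_zeros g u -> vanishing_on_zeros g (c *: u).
Proof. by move=> hu a ga; rewrite mevalZ hu // mulr0. Qed.

Lemma vanishM g u v : vanishing_on_zeros g v -> vanishing_on_zeros g (u * v).
Proof. by move=> hv a ga; rewrite mevalM hv // mulr0. Qed.

(** The zeros of [g] project densely along x_j: over a point where the leading coefficient in x_j is
    nonzero, algebraic closedness gives a root. If [c] is nonzero there too, this root contradicts
    the vanishing. *)
Lemma contraction_eq0 g j c : (1 < size (split_var j g))%N ->
  vanishing_on_zeros g (lift_var j c) -> c = 0.
Proof.
move=> szg vc; apply/eqP/negP => /negP c0.
have l0 : lead_coef (split_var j g) != 0.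
  by rewrite lead_coef_eq0 -size_poly_gt0 ltnW.
have [e] : exists e, (c * lead_coef (split_var j g)).@[e] != 0.
  by apply: mpoly_nonzero_value; rewrite mulf_neq0.
rewrite mevalM mulf_eq0 negb_or => /andP[ce le].
have [x rx] : exists x, root (map_poly (meval e) (split_var j g)) x.
  by apply: closed_rootP; rewrite size_map_poly_id0 // neq_ltn szg orbT.
pose b i := if unlift j i is Some k then e k else x.
have bE : b \o lift j =1 e by move=> k; rewrite /b /= liftK.
have gb : g.@[b] = 0.
  rewrite (meval_split_var j) /b unlift_none -[RHS](eqP rx) -/b.
  congr (_.[_]); apply/polyP => i; rewrite !coef_map; exact: meval_eq.
by move: ce; rewrite -(meval_eq c bE) -meval_lift_var vc ?eqxx.
Qed.

Lemma exists_split_var g d : g != 0 -> (0 < d)%N -> g \is d.-homog ->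
  exists j, (1 < size (split_var j g))%N.
Proof.
move=> g0 d0 /dhomogP gd.
have [m mg] := exists_msupp g0.
have /existsNP[j /eqP mj] : ~ forall j, m j = 0%N.
  by move=> H; move: d0; rewrite -(gd _ mg) /= mdegE big1.
exists j; apply: (@split_var_size_gt1 _ _ _ _ m); first by rewrite -mcoeff_msupp.
by rewrite lt0n.
Qed.

(** The product of [f] with all variables vanishes on every zero of [g]. The variables are then
    cancelled one by one, since none vanishes at the torus point. *)
Lemma vanish_of_torus g f : prime_vanishing g ->
  (exists2 p, torus p & g.@[p] = 0) ->
  (forall p, torus p -> g.@[p] = 0 -> f.@[p] = 0) -> vanishing_on_zeros g f.
Proof.
move=> gP [p tp gp] H.
suff : vanishing_on_zeros g (\prod_(j <- index_enum 'I_n.+1) 'X_j * f).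
  elim: index_enum => [|j s IH]; first by rewrite big_nil mul1r.
  rewrite big_cons -mulrA => /gP[/(_ p gp)/eqP|/IH//].
  by rewrite mevalXU (negPf (tp j)).
move=> a ga; rewrite mevalM rmorph_prod /=.
have [ta|/existsNP[j /negP]] := pselect (torus a); first by rewrite H // mulr0.
by rewrite negbK => /eqP aj; rewrite (bigD1 j) //= mevalXU aj !mul0r.
Qed.

Lemma eval_homog g d a (c : K) : g \is d.-homog ->
  g.@[fun i => c * a i] = c ^+ d * g.@[a].
Proof.
move=> /dhomogP gd; rewrite !meval_mon big_distrr /=.
rewrite !big_seq; apply: eq_bigr => m /gd <- /=.
rewrite /mon mdegE expr_sum mulrCA -big_split /=.
by congr (_ * _); apply: eq_bigr => i _; rewrite exprMn.
Qed.

(* X^m / X^m' is constant on the torus points of Z(g), denominators cleared. *)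
Definition sim g m m' : Prop := forall p q, torus p -> torus q ->
  g.@[p] = 0 -> g.@[q] = 0 -> mon p m * mon q m' = mon q m * mon p m'.

(** Normalised to vanish at [q]; for a torus zero [q] of [g], these are the binomials that [sim]
    puts into the ideal. *)
Definition tbinomial q m m' : {mpoly K[n.+1]} :=
  mon q m' *: 'X_[m] - mon q m *: 'X_[m'].

Lemma meval_tbinomial q m m' a :
  (tbinomial q m m').@[a] = mon q m' * mon a m - mon q m * mon a m'.
Proof. by rewrite mevalB !mevalZ !mevalX. Qed.

Lemma sim_refl g m : sim g m m.
Proof. by move=> p q *; rewrite mulrC. Qed.

Lemma sim_sym g m m' : sim g m m' -> sim g m' m.
Proof. by move=> H p q tp tq gp gq; rewrite mulrC -H // mulrC. Qed.

Lemma simD g m1 m1' m2 m2' : sim g m1 m1' -> sim g m2 m2' ->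
  sim g (m1 + m2)%MM (m1' + m2')%MM.
Proof.
move=> H1 H2 p q tp tq gp gq; rewrite !monD.
by rewrite mulrACA H1 // H2 // mulrACA.
Qed.

Lemma sim_addr g k m m' : sim g (m + k)%MM (m' + k)%MM -> sim g m m'.
Proof.
move=> H p q tp tq gp gq; have := H p q tp tq gp gq; rewrite !monD.
rewrite mulrACA [RHS]mulrACA [mon q k * _]mulrC.
by apply: mulIf; rewrite mulf_neq0 ?mon_neq0.
Qed.

Lemma simMn g k m m' : sim g m m' -> sim g (m *+ k)%MM (m' *+ k)%MM.
Proof.
move=> H; elim: k => [|k IH]; first by rewrite !mulm0n; apply: sim_refl.
by rewrite !mulmS; apply: simD.
Qed.

Lemma sim_tbinomial g q m m' : torus_hypersurface g -> torus q -> g.@[q] = 0 ->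
  sim g m m' -> vanishing_on_zeros g (tbinomial q m m').
Proof.
move=> [_ _ gP gt] tq gq H; apply: vanish_of_torus => // p tp gp.
by rewrite meval_tbinomial mulrC H // subrr.
Qed.

(** Compare a torus zero [p] with [2 * p], again a zero by homogeneity. *)
Lemma sim_mdeg g m m' : torus_hypersurface g -> sim g m m' -> mdeg m = mdeg m'.
Proof.
move=> [_ [d _ gd] _ [p tp gp]] H.
pose q i := 2 * p i.
have tq : torus q by move=> i; rewrite mulf_neq0 ?pnatr_eq0.
have gq : g.@[q] = 0 by rewrite (eval_homog _ _ gd) gp mulr0.
have monq k : mon q k = 2 ^+ mdeg k * mon p k.
  have := @eval_homog 'X_[k] (mdeg k) p 2.
  by rewrite dhomogX eqxx !mevalX => /(_ isT).
have := H p q tp tq gp gq; rewrite !monq mulrCA -mulrA => /mulIf-/(_ _)/eqP.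
rewrite mulf_neq0 ?mon_neq0 // => /(_ isT).
by rewrite -!natrX eqr_nat eqn_exp2l // => /eqP.
Qed.

(** Equal powers of x_j cancel, so the binomial [c] in the remaining variables vanishes on the zeros
    of [g]. Hence [c] is zero, and its two monomials coincide. *)
Lemma sim_rank1 g j m m' : torus_hypersurface g -> (1 < size (split_var j g))%N ->
  sim g m m' -> m j = m' j -> m = m'.
Proof.
move=> gH szg H mj; have [_ _ gP gt] := gH; have [q tq gq] := gt.
pose r m := [multinom (m : 'X_{1..n.+1}) (lift j i) | i < n].
have monE p k : mon p k = p j ^+ k j * mon (p \o lift j) (r k).
  rewrite /mon (bigD1_ord j) //=; congr (_ * _); apply: eq_bigr => i _.
  by rewrite mnmE.
have tl p k : torus p -> mon (p \o lift j) k != 0.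
  by move=> tp; apply: mon_neq0 => i; apply: tp.
pose c : {mpoly K[n]} :=
  mon (q \o lift j) (r m') *: 'X_[r m] - mon (q \o lift j) (r m) *: 'X_[r m'].
have c0 : c = 0.
  apply: (contraction_eq0 szg); apply: vanish_of_torus => // p tp gp.
  rewrite meval_lift_var mevalB !mevalZ !mevalX.
  have := H p q tp tq gp gq; rewrite !monE -mj mulrACA [RHS]mulrACA [q j ^+ _ * _]mulrC.
  move/mulfI; rewrite mulf_neq0 ?expf_neq0 // => /(_ isT) E.
  by rewrite mulrC -/(mon _ _) E subrr.
have rE : r m = r m'.
  apply/eqP/negP => /negP rm; have := congr1 (mcoeff (r m)) c0.
  rewrite mcoeff0 mcoeffB !mcoeffZ !mcoeffX eqxx eq_sym (negPf rm).
  by rewrite mulr1 mulr0 subr0 => /eqP; rewrite (negPf (tl _ _ tq)).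
apply/mnmP => i; case: (unliftP j i) => [k ->|-> //].
by have := congr1 (fun s : 'X_{1..n} => s k) rE; rewrite /r /= !mnmE.
Qed.

End VanishingOnHypersurface.

(** * Hadamard products of cones *)

Section AffineHadamard.
Variables (K : numClosedFieldType) (n : nat).
Implicit Types (f g h u v : {mpoly K[n.+1]}) (m : 'X_{1..n.+1}).
Implicit Types (a b p q t : 'I_n.+1 -> K).

(** The Zariski closure in terms of ideals: the zeros of [h] have the same ideal as the set of
    coordinatewise products. *)
Definition hadamard_cone g g' h : Prop := forall u,
  vanishing_on_zeros h u <->
  forall a b, g.@[a] = 0 -> g'.@[b] = 0 -> u.@[mulpt a b] = 0.

Lemma hadamard_coneC g g' h : hadamard_cone g g' h -> hadamard_cone g' g h.
Proof.
move=> H u; rewrite H; split=> E a b ga gb; rewrite -[RHS](E b a) //;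
  by apply: meval_eq => i; rewrite /mulpt mulrC.
Qed.

(** The image of a product of irreducible varieties is irreducible; primality is used once in each
    factor. *)
Lemma hadamard_prime g g' h : prime_vanishing g -> prime_vanishing g' ->
  hadamard_cone g g' h -> prime_vanishing h.
Proof.
move=> gP g'P H u v uv.
apply: contrapT => /not_orP[/H Hu /H Hv]; move: Hu Hv.
move=> /existsNP[a1] /existsNP[b1] /not_implyP[ga1] /not_implyP[gb1 u1].
move=> /existsNP[a2] /existsNP[b2] /not_implyP[ga2] /not_implyP[gb2 v2].
(* Primality in the second factor replaces [b1] and [b2] by a single [b]. *)
have [b [gb ub vb]] : exists b, [/\ g'.@[b] = 0, u.@[mulpt a1 b] <> 0 & v.@[mulpt a2 b] <> 0].
  apply: contrapT => Hb.
  have /g'P[/(_ b1 gb1)|/(_ b2 gb2)] :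
      vanishing_on_zeros g' (scale_poly a1 u * scale_poly a2 v).
  - move=> b gb; rewrite mevalM !meval_scale_poly; apply/eqP; rewrite mulf_eq0.
    apply/negP => /negP; rewrite negb_or => /andP[/eqP ub /eqP vb].
    by apply: Hb; exists b.
  - by rewrite meval_scale_poly.
  - by rewrite meval_scale_poly.
have E w a : (scale_poly b w).@[a] = w.@[mulpt a b].
  by rewrite meval_scale_poly; apply: meval_eq => i; rewrite /mulpt mulrC.
(* With [b] fixed, primality in the first factor forces [u] or [v] to vanish at a point where it
   does not. *)
have /gP[/(_ a1 ga1)|/(_ a2 ga2)] :
    vanishing_on_zeros g (scale_poly b u * scale_poly b v).
- by move=> a ga; rewrite mevalM !E -mevalM; apply: (H (u * v)).1.
- by rewrite E.
- by rewrite E.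
Qed.

(* For a torus point p of the first hypersurface, the translate by p of the
   second one is an irreducible hypersurface inside the Hadamard product, hence
   equal to it. *)
Lemma vanish_translate g g' h p u :
  torus_hypersurface g -> torus_hypersurface g' -> h != 0 ->
  hadamard_cone g g' h -> torus p -> g.@[p] = 0 ->
  vanishing_on_zeros h u <-> vanishing_on_zeros g' (scale_poly p u).
Proof.
move=> [_ _ gP _] [g'0 [d d0 g'd] g'P _] h0 H tp gp.
have sub v : vanishing_on_zeros h v -> vanishing_on_zeros g' (scale_poly p v).
  by move=> /H E b gb; rewrite meval_scale_poly E.
split; first exact: sub.
have hP := hadamard_prime gP g'P H.
have [j szj] := exists_split_var g'0 d0 g'd.
move=> gu; rewrite -(split_varK j u).
(* [P] and [Q] are the ideals of the product and of the translate, read in x_j. [Q] contracts to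
   zero because scaling by [p] preserves polynomials free of x_j. *)
pose P w := vanishing_on_zeros h (join_var j w).
pose Q w := vanishing_on_zeros g' (scale_poly p (join_var j w)).
apply: (@eq_prime_of_contraction0 _ P Q); rewrite /P /Q.
- by move=> v w; rewrite rmorphM; apply: vanishM.
- move=> v w Hv Hw b gb; rewrite meval_scale_poly rmorphB mevalB.
  by rewrite -!meval_scale_poly Hv // Hw // subrr.
- move=> v w Hw b gb; rewrite meval_scale_poly rmorphM mevalM.
  by rewrite -!meval_scale_poly Hw // mulr0.
- by move=> v w; rewrite rmorphM; apply: hP.
- by move=> w; apply: sub.
- move=> c Hc; have c0 : scale_poly (p \o lift j) c = 0.
    apply: (contraction_eq0 szj) => b gb.
    rewrite meval_lift_var meval_scale_poly.
    by have := Hc b gb; rewrite meval_scale_poly join_varC meval_lift_var.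
  apply/mpolyP => m; rewrite mcoeff0.
  have := congr1 (mcoeff m) c0; rewrite mcoeff_mweight mcoeff0 => /eqP.
  have tl : torus (p \o lift j) by move=> i; apply: tp.
  by rewrite mulf_eq0 (negPf (mon_neq0 _ tl)) => /eqP.
- exists (split_var j h); first by rewrite split_varK.
  by apply: contraNneq h0 => E; rewrite -(split_varK j h) E rmorph0.
- by rewrite split_varK.
Qed.

(** The translates by [p] and by [q] have the same ideal, that of [h]; going up through [p] and down
    through [q] substitutes [q / p]. *)
Lemma translate_stabilises g g' h p q :
  torus_hypersurface g -> torus_hypersurface g' -> h != 0 ->
  hadamard_cone g g' h -> torus p -> g.@[p] = 0 -> torus q -> g.@[q] = 0 ->
  stabilises (vanishing_on_zeros g') (divpt q p).
Proof.
move=> gH g'H h0 H tp gp tq gq f gf.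
pose one : 'I_n.+1 -> K := fun=> 1.
pose u := scale_poly (divpt one p) f.
have hu : vanishing_on_zeros h u.
  apply/(vanish_translate _ gH g'H h0 H tp gp) => b gb.
  rewrite !meval_scale_poly -[RHS](gf b gb); apply: meval_eq => i.
  by rewrite /mulpt /divpt /one mul1r mulKf.
move/(vanish_translate _ gH g'H h0 H tq gq): hu => hu b /hu.
rewrite !meval_scale_poly => E; rewrite -[RHS]E; apply: meval_eq => i.
by rewrite /mulpt /divpt /one mul1r mulrCA mulrA.
Qed.

(** Equal characters agree on every [q / p], which stabilises the ideal of [g'] when [p] and [q] are
    torus zeros of [g]. *)
Lemma same_character_sim g g' h m m' :
  torus_hypersurface g -> torus_hypersurface g' -> h != 0 ->
  hadamard_cone g g' h ->
  same_character (vanishing_on_zeros g') m m' -> sim g m m'.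
Proof.
move=> gH g'H h0 H E p q tp tq gp gq.
have := E _ (translate_stabilises gH g'H h0 H tp gp tq gq).
rewrite !mon_divpt => /eqP; rewrite eqr_div ?mon_neq0 // => /eqP ->.
by rewrite mulrC.
Qed.

(** If the characters differed, the component of a binomial in the ideal would be a single monomial
    in the ideal, yet monomials do not vanish at torus points. *)
Lemma sim_same_character g m m' : torus_hypersurface g -> sim g m m' ->
  same_character (vanishing_on_zeros g) m m'.
Proof.
move=> gH S; apply: contrapT => E; have [_ _ _ [q tq gq]] := gH.
have nE : m' != m by apply/eqP => mm; apply: E; rewrite mm.
have := component_stable (@vanishB _ _ g) (@vanishZ _ _ g) m
  (sim_tbinomial gH tq gq S).
suff -> : component (vanishing_on_zeros g) m (tbinomial q m m') = mon q m' *: 'X_[m].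
  move=> /(_ q gq)/eqP; rewrite mevalZ mevalX mulf_eq0 -/(mon q m).
  by rewrite !(negPf (mon_neq0 _ tq)).
apply/mpolyP => k; rewrite mcoeff_mweight mcoeffB !mcoeffZ !mcoeffX.
have [<-|_] := eqVneq m k.
  by rewrite (negPf nE) asboolT // mulr0 subr0 mul1r.
have [<-|_] := eqVneq m' k; last by rewrite !mulr0 subrr mulr0.
by rewrite asboolF ?mul0r ?mulr0 // => E'; apply: E => t /E'.
Qed.

Lemma sim_transfer g g' h m m' :
  torus_hypersurface g -> torus_hypersurface g' -> h != 0 ->
  hadamard_cone g g' h -> sim g' m m' -> sim g m m'.
Proof.
by move=> gH g'H h0 H S; apply: (same_character_sim gH g'H h0 H); apply: sim_same_character.
Qed.

Lemma exists_minimal_sim g j : torus_hypersurface g -> (1 < size (split_var j g))%N ->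
  (exists m m', m <> m' /\ sim g m m') ->
  exists I J, [/\ sim g I J, (0 < I j)%N, J j = 0%N,
    (forall i, I i = 0%N \/ J i = 0%N) &
    forall m m', sim g m m' -> (m' j < m j)%N -> (m' j + I j <= m j)%N].
Proof.
move=> gH szj [m0 [m0' [m0N S0]]].
pose T d := (0 < d)%N && `[< exists m m', sim g m m' /\ m j = (m' j + d)%N >].
have exT : exists d, T d.
  have [lt|lt|E] := ltngtP (m0 j) (m0' j).
  - exists (m0' j - m0 j)%N; rewrite /T subn_gt0 lt; apply/asboolP.
    by exists m0', m0; split; [apply: sim_sym | rewrite subnKC // ltnW].
  - exists (m0 j - m0' j)%N; rewrite /T subn_gt0 lt; apply/asboolP.
    by exists m0, m0'; split; rewrite // subnKC // ltnW.
  - by case: m0N; apply: sim_rank1 gH szj S0 E.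
case: (ex_minnP exT) => d /andP[d0 /asboolP[m [m' [S mj]]]] dmin.
(* Truncated subtraction removes the common factor of the pair, leaving disjoint supports. *)
pose I := (m - m')%MM; pose J := (m' - m)%MM.
exists I, J; split.
- apply: (@sim_addr _ _ _ (m - I)%MM).
  rewrite (_ : I + _ = m)%MM 1?(_ : J + _ = m')%MM //; apply/mnmP => i;
    by rewrite !mnmDE !mnmBE; lia.
- by rewrite mnmBE; lia.
- by rewrite mnmBE; lia.
- by move=> i; rewrite !mnmBE; lia.
- move=> k k' Sk lt; rewrite mnmBE.
  have := dmin (k j - k' j)%N; rewrite /T subn_gt0 lt => /(_ _)/implyP.
  rewrite asboolT /=; first by lia.
  by exists k, k'; split; rewrite // subnKC // ltnW.
Qed.

(** * The binomial of a minimal pair as generator *)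

Section Generator.
Variables (g : {mpoly K[n.+1]}) (j : 'I_n.+1) (I J : 'X_{1..n.+1}).
Hypotheses (gH : torus_hypersurface g) (szj : (1 < size (split_var j g))%N).
Hypotheses (SIJ : sim g I J) (Ij : (0 < I j)%N) (Jj : J j = 0%N).
Hypothesis disjIJ : forall i, I i = 0%N \/ J i = 0%N.
Hypothesis minIJ : forall m m', sim g m m' -> (m' j < m j)%N -> (m' j + I j <= m j)%N.

(** Raising the two pairs to suitable powers equalises the exponents of x_j, so [E] follows from
    rank one. Where [J] is zero, [E] and [d <= e] bound [I] by [m]; elsewhere [I] is zero. *)
Lemma minimal_sim_le m m' : sim g m m' -> (m' j < m j)%N -> (I <= m)%MM.
Proof.
move=> S lt; have le := minIJ S lt.
pose d := I j; pose e := (m j - m' j)%N.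
have E : (m *+ d + J *+ e = m' *+ d + I *+ e)%MM.
  apply: (sim_rank1 gH szj).
    by apply: simD; apply: simMn => //; apply: sim_sym.
  rewrite !mnmDE !mulmnE Jj mul0n addn0 -/d.
  by rewrite mulnC [(m' j * d)%N]mulnC [(d * e)%N]mulnC mulnC /e; nia.
apply/mnm_lepP => i.
have := congr1 (fun k : 'X_{1..n.+1} => k i) E; rewrite /= !mnmDE !mulmnE.
case: (disjIJ i) => [->//|->]; rewrite mul0n addn0 => Ei.
rewrite -(leq_pmul2r (m := d)) // Ei.
have : (I i * d <= I i * e)%N by rewrite leq_mul2l /d /e; apply/orP; right; lia.
by lia.
Qed.

(** Division by descent on the exponent of x_j: replacing the factor X^I of X^m by X^J lowers it by
    [I j] and keeps the ratio constant. *)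
Lemma tbinomial_divides q m m' : torus q -> sim g m m' ->
  exists h, tbinomial q m m' = h * tbinomial q I J.
Proof.
move=> tq.
wlog le : m m' / (m' j <= m j)%N.
  move=> H S; case: (leqP (m' j) (m j)) => [le|/ltnW le]; first exact: H.
  have [h E] := H m' m le (sim_sym S).
  by exists (- h); rewrite mulNr -E /tbinomial opprB.
have [k] := ubnP (m j); elim: k m le => // k IH m le mk S.
move: le; rewrite leq_eqVlt => /orP[/eqP E|lt].
  by exists 0; rewrite mul0r (sim_rank1 gH szj S (esym E)) /tbinomial subrr.
have Im := minimal_sim_le S lt; have le := minIJ S lt.
pose r := (m - I)%MM.
have mE : m = (I + r)%MM by rewrite /r addmC submK.
have rj : (r j + I j = m j)%N by rewrite mE mnmDE addnC.
have Sr : sim g (J + r)%MM m'.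
  have S1 : sim g (J + r)%MM m.
    by rewrite mE; apply: simD; [apply: sim_sym | apply: sim_refl].
  apply: (@sim_addr _ _ _ m).
  by rewrite [X in sim _ _ X]addmC; apply: simD.
(* Minimality keeps the exponent of x_j in [J + r] at least [m' j]. *)
have [||h E] := IH (J + r)%MM _ _ Sr; rewrite ?mnmDE ?Jj; [lia | lia |].
exists ((mon q J)^-1 *: (mon q m' *: 'X_[r] + mon q I *: h)).
rewrite -scalerAl mulrDl -[_ *: h * _]scalerAl -E /tbinomial mE.
apply: (scalerI (mon_neq0 J tq)); rewrite scalerA mulfV ?mon_neq0 // scale1r.
rewrite !mpolyXD !monD -!mul_mpolyC !rmorphM /=.
by ring.
Qed.

(** Components are split off one at a time, each a combination of binomials. A separate [g'] appears
    so that the pair found for [g] serves both factors. *)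
Lemma hypersurface_binomial g' q f :
  torus_hypersurface g' -> torus q -> g'.@[q] = 0 -> sim g' I J ->
  (forall m m', same_character (vanishing_on_zeros g') m m' -> sim g m m') ->
  vanishing_on_zeros g' f <-> exists h, f = h * tbinomial q I J.
Proof.
move=> g'H tq g'q S'IJ char_sim; split; last first.
  by case=> h ->; apply: vanishM; apply: sim_tbinomial.
have [k] := ubnP (size (msupp f)); elim: k f => // k IH f fk g'f.
have [->|f0] := eqVneq f 0; first by exists 0; rewrite mul0r.
have [m0 m0f] := exists_msupp f0.
pose f0' := component (vanishing_on_zeros g') m0 f.
have g'f0 : vanishing_on_zeros g' f0'.
  exact: (component_stable (@vanishB _ _ g') (@vanishZ _ _ g')).
have [h1 E1] : exists h, f - f0' = h * tbinomial q I J.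
  apply: IH; last exact: vanishB.
  apply: leq_trans (_ : size (msupp f) <= k)%N => //.
  have cE m : (f - f0')@_m =
      (1 - (`[< same_character (vanishing_on_zeros g') m m0 >])%:R) * f@_m.
    by rewrite mcoeffB mcoeff_mweight mulrBl mul1r.
  have : {subset m0 :: msupp (f - f0') <= msupp f}.
    move=> m; rewrite inE => /orP[/eqP->//|]; rewrite !mcoeff_msupp cE.
    by apply: contraNneq => ->; rewrite mulr0.
  move/uniq_leq_size; apply; rewrite /= msupp_uniq andbT mcoeff_msupp cE.
  by rewrite asboolT // subrr mul0r eqxx.
have [h2 E2] : exists h, mon q m0 *: f0' = h * tbinomial q I J.
  (* The second terms of the binomials add up to the value of [f0'] at [q] times X^m0, which is
     zero. *)
  have -> : mon q m0 *: f0' = \sum_(m <- msupp f0') f0'@_m *: tbinomial q m m0.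
    under eq_bigr do rewrite /tbinomial scalerBr.
    rewrite sumrB [X in _ - X](_ : _ = f0'.@[q] *: 'X_[m0]).
      rewrite g'f0 // scale0r subr0 [in LHS](mpolyE f0') scaler_sumr.
      by apply: eq_bigr => m _; rewrite !scalerA mulrC.
    rewrite meval_mon scaler_suml; apply: eq_bigr => m _.
    by rewrite scalerA.
  rewrite big_seq; apply: (big_ind (fun w => exists h, w = h * tbinomial q I J)).
  - by exists 0; rewrite mul0r.
  - by move=> _ _ [x ->] [y ->]; exists (x + y); rewrite mulrDl.
  move=> m; rewrite mcoeff_msupp mcoeff_mweight.
  case: asboolP => [/char_sim/(tbinomial_divides tq)[h ->] _|]; last by rewrite mul0r eqxx.
  by eexists; rewrite scalerAl.
exists (h1 + (mon q m0)^-1 *: h2); rewrite mulrDl -E1 -scalerAl -E2.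
by rewrite scalerA mulVf ?mon_neq0 // scale1r subrK.
Qed.

End Generator.

(** [sim] is the same relation for both factors, so one minimal pair generates both ideals, with
    coefficients read off at torus zeros [p] and [q]. *)
Theorem hadamard_cone_binomial g g' h :
  torus_hypersurface g -> torus_hypersurface g' -> h != 0 ->
  hadamard_cone g g' h ->
  exists I J p q, [/\ I != J, mdeg I = mdeg J, torus p & torus q] /\
    [/\ forall f, vanishing_on_zeros g f <-> exists r, f = r * tbinomial p I J,
        forall f, vanishing_on_zeros g' f <-> exists r, f = r * tbinomial q I J
      & forall x, h.@[x] = 0 <-> (tbinomial (mulpt p q) I J).@[x] = 0].
Proof.
move=> gH g'H h0 H; have H' := hadamard_coneC H.
have [g0 [d d0 gd] _ [p tp gp]] := gH; have [_ _ _ [q tq g'q]] := g'H.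
have simE m m' : sim g m m' <-> sim g' m m'.
  by split; [apply: sim_transfer g'H gH h0 H' | apply: sim_transfer gH g'H h0 H].
have char_g m m' : same_character (vanishing_on_zeros g) m m' -> sim g m m'.
  by move=> /(same_character_sim g'H gH h0 H')/simE.
have char_g' m m' : same_character (vanishing_on_zeros g') m m' -> sim g' m m'.
  by move=> /(same_character_sim gH g'H h0 H)/simE.
have [j szj] := exists_split_var g0 d0 gd.
(* Otherwise every component of [g] is a single term, and a monomial would lie in the ideal. *)
have [m [m' [mN S]]] : exists m m', m <> m' /\ sim g m m'.
  apply: contrapT => Hn.
  have [m0 m0g] := exists_msupp g0.
  have := component_stable (@vanishB _ _ g) (@vanishZ _ _ g) m0 (fun a ga => ga : g.@[a] = 0).
  suff -> : component (vanishing_on_zeros g) m0 g = g@_m0 *: 'X_[m0].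
    move=> /(_ p gp)/eqP; rewrite mevalZ mevalX mulf_eq0 -/(mon p m0).
    by rewrite (negPf (mon_neq0 _ tp)) orbF -[_ == 0]negbK -mcoeff_msupp m0g.
  apply/mpolyP => k; rewrite mcoeff_mweight mcoeffZ mcoeffX.
  have [<-|kN] := eqVneq m0 k; first by rewrite asboolT // mulr1 mul1r.
  rewrite asboolF ?mul0r ?mulr0 // => /char_g Sk.
  by apply: Hn; exists k, m0; split => //; apply/eqP; rewrite eq_sym.
have [|I [J [SIJ Ij Jj disj minIJ]]] := exists_minimal_sim gH szj; first by exists m, m'.
have gen_g f := hypersurface_binomial gH szj SIJ Ij Jj disj minIJ f gH tp gp SIJ char_g.
have S'IJ := (simE I J).1 SIJ.
have char_g'g m1 m2 : same_character (vanishing_on_zeros g') m1 m2 -> sim g m1 m2.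
  by move/char_g'/simE.
have gen_g' f := hypersurface_binomial gH szj SIJ Ij Jj disj minIJ f g'H tq g'q S'IJ char_g'g.
exists I, J, p, q; split; first split => //.
- by apply: contraTneq Ij => ->; rewrite Jj.
- exact: sim_mdeg gH SIJ.
split => // x; split.
  apply: (H _).2 => {x} a b ga g'b.
  have := (gen_g (tbinomial p I J)).2 (ex_intro _ 1 (esym (mul1r _))) a ga.
  have := (gen_g' (tbinomial q I J)).2 (ex_intro _ 1 (esym (mul1r _))) b g'b.
  rewrite !meval_tbinomial !mon_mulpt => /eqP; rewrite subr_eq0 => /eqP Eb.
  move=> /eqP; rewrite subr_eq0 => /eqP Ea.
  by rewrite mulrACA Ea Eb mulrACA subrr.
rewrite meval_tbinomial !mon_mulpt => /eqP; rewrite subr_eq0 => /eqP Ex.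
(* Conversely x is the product of [p] and [x / p], and the binomial equation at x makes [x / p] a
   zero of [g']. *)
have bx : g'.@[divpt x p] = 0.
  have [r ->] := (gen_g' g').1 (fun a ga => ga).
  rewrite mevalM meval_tbinomial !mon_divpt.
  suff -> : mon q J * (mon x I / mon p I) = mon q I * (mon x J / mon p J).
    by rewrite subrr mulr0.
  rewrite !mulrA; apply/eqP; rewrite eqr_div ?mon_neq0 //; apply/eqP.
  by rewrite mulrC mulrA Ex [RHS]mulrC mulrA.
have := (H h).1 (fun a ha => ha) p (divpt x p) gp bx.
by rewrite (meval_eq _ (divptK x tp)).
Qed.

End AffineHadamard.

(** * Projective hypersurfaces and their cones *)

Section ProjectiveCone.
Variables (R : realType) (n : nat).
Implicit Types (f g h u v : {mpoly R[i][n.+1]}) (p q r : proj_space R n).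
Implicit Types (a b : 'rV[R[i]]_n.+1) (c : R[i]) (V : set (proj_space R n)).

Lemma exists_point a : a != 0 -> exists p, coords p a.
Proof.
move=> a0; have da : (\dim <[a]>%VS == 1)%N by rewrite dim_vline a0.
by exists (exist _ <[a]>%VS da).
Qed.

Lemma exists_coords p : exists a, coords p a.
Proof.
case: p => L dL; exists (vpick L).
have v0 : vpick L != 0.
  by rewrite vpick0; apply: contraTneq dL => ->; rewrite dimv0.
split => //=; apply/esym/eqP; rewrite eqEdim dim_vline v0 (eqP dL) andbT.
by rewrite -memvE memv_pick.
Qed.

Lemma coords_proportional p a b : coords p a -> coords p b ->
  exists2 c : R[i], c != 0 & b = c *: a.
Proof.
move=> [a0 pa] [b0 pb]; have /vlineP[c bE] : b \in <[a]>%VS by rewrite -pa pb memv_line.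
by exists c => //; apply: contraNneq b0 => c0; rewrite bE c0 scale0r.
Qed.

Lemma coordsZ p a (c : R[i]) : c != 0 -> coords p a -> coords p (c *: a).
Proof.
move=> c0 [a0 pa]; split; first by rewrite scaler_eq0 negb_or c0.
apply/eqP; rewrite pa eqEdim !dim_vline a0 leq_b1 andbT.
by rewrite -memvE; apply/vlineP; exists c^-1; rewrite scalerA mulVf // scale1r.
Qed.

Lemma eval_at_row f (t : 'I_n.+1 -> R[i]) : eval_at f (\row_j t j) = f.@[t].
Proof. by apply: meval_eq => j; rewrite mxE. Qed.

Lemma eval_atZ f d (c : R[i]) a : f \is d.-homog ->
  eval_at f (c *: a) = c ^+ d * eval_at f a.
Proof.
by move=> fd; rewrite -(eval_homog _ _ fd); apply: meval_eq => j; rewrite mxE.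
Qed.

Lemma homog_eval0 f d : (0 < d)%N -> f \is d.-homog -> eval_at f 0 = 0.
Proof.
by move=> d0 fd; rewrite -(scale0r 0) (eval_atZ _ _ fd) expr0n eqn0Ngt d0 mul0r.
Qed.

Lemma vanishes_homog f d p a : f \is d.-homog -> coords p a ->
  vanishes_at f p <-> eval_at f a = 0.
Proof.
move=> fd pa; split=> [/(_ a pa)//|fa b /(coords_proportional pa)[c _ ->]].
by rewrite (eval_atZ _ _ fd) fa mulr0.
Qed.

(** The restriction of [u] to the line through [a], as a polynomial in the scalar; this handles
    inhomogeneous [u]. *)
Definition line_poly u a : {poly R[i]} :=
  \poly_(d < msize u) eval_at (pihomog mdeg d u) a.

Lemma horner_line_poly u a c : (line_poly u a).[c] = eval_at u (c *: a).
Proof.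
rewrite horner_poly [in RHS](@pihomog_partitionE _ _ mdeg _ u (leqnn _)).
rewrite {2}/eval_at raddf_sum; apply: eq_bigr => d _ /=.
by rewrite -/(eval_at _ _) (eval_atZ _ _ (pihomogP _ _ _)) mulrC.
Qed.

Lemma line_poly_eq0 u p a : coords p a -> vanishes_at u p <-> line_poly u a = 0.
Proof.
move=> pa; split=> [up|E b /(coords_proportional pa)[c _ ->]].
  apply: poly_eq0_of_nonzero_roots => c c0.
  by rewrite horner_line_poly; apply: up; apply: coordsZ.
by rewrite -horner_line_poly E horner0.
Qed.

Lemma vanishes_pihomog u p :
  vanishes_at u p <-> forall d, vanishes_at (pihomog mdeg d u) p.
Proof.
split=> [up d b /[dup] pb /(line_poly_eq0 u)/iffLR/(_ up) E|H b pb].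
  have [dlt|dge] := ltnP d (msize u).
    by have := congr1 (fun P : {poly R[i]} => P`_d) E; rewrite coef_poly dlt coef0.
  rewrite /eval_at pihomogE big_seq_cond big_pred0 ?meval0 // => m.
  apply/negP => /andP[/msize_mdeg_lt mlt /eqP md]; move: mlt.
  by rewrite ltnNge -[mdeg m]/(mdeg m : nat) md dge.
rewrite (@pihomog_partitionE _ _ mdeg _ u (leqnn _)) /eval_at raddf_sum.
by apply: big1 => d _; apply: H.
Qed.

Lemma zero_set_closed u : zariski_closed (zero_set u).
Proof.
exists [set f | exists d, f = pihomog mdeg d u]; split.
  by move=> _ [d ->]; exists d; apply: pihomogP.
rewrite predeqE => p; rewrite /zero_set /= vanishes_pihomog.
by split=> [H _ [d ->]|H d]; apply: H; exists d.
Qed.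

Lemma zariski_closedI V W :
  zariski_closed V -> zariski_closed W -> zariski_closed (V `&` W).
Proof.
move=> [F [Fh ->]] [G [Gh ->]]; exists (F `|` G); split.
  by move=> f [/Fh|/Gh].
rewrite predeqE => p; split=> [[HF HG] f [/HF|/HG]//|H].
by split=> f Hf; apply: H; [left|right].
Qed.

Lemma vanishing_ideal_zero_set g d f : (0 < d)%N -> g \is d.-homog ->
  zero_set g !=set0 ->
  vanishing_ideal (zero_set g) f <-> vanishing_on_zeros g f.
Proof.
move=> d0 gd [p0 gp0]; split=> [H t gt|H p gp a pa]; last first.
  by apply: H; apply: gp.
rewrite -eval_at_row; move: gt; rewrite -eval_at_row.
(* The origin is no projective point; there [f] vanishes because it vanishes along the whole line
   over [p0]. *)
have [->|a0 ga] := eqVneq (\row_j t j) 0.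
  move=> _; have [b pb] := exists_coords p0.
  have /(line_poly_eq0 f pb) E := H _ gp0.
  by rewrite -(scale0r b) -horner_line_poly E horner0.
have [p pa] := exists_point a0.
by apply: (H p) => //; apply/(vanishes_homog gd pa).
Qed.

(** At each point of [V] the product of the two line polynomials is zero, hence one of them is; so
    [V] is covered by two closed pieces. *)
Lemma irreducible_prime V u v : zariski_closed V -> irreducible_set V ->
  vanishing_ideal V (u * v) -> vanishing_ideal V u \/ vanishing_ideal V v.
Proof.
move=> cV [_ irrV] uv.
have : V = (V `&` zero_set u) `|` (V `&` zero_set v).
  rewrite predeqE => p; split=> [Vp|[[]|[]]//].
  have [a pa] := exists_coords p.
  suff : line_poly u a * line_poly v a = 0.
    move/eqP; rewrite mulf_eq0 => /orP[] /eqP /(line_poly_eq0 _ pa) ?.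
      by left.
    by right.
  apply: poly_eq0_of_nonzero_roots => c c0.
  by rewrite hornerM !horner_line_poly -mevalM; apply: (uv p) => //; apply: coordsZ.
move=> VE; have cI w := zariski_closedI cV (zero_set_closed w).
by case: (irrV _ _ (cI u) (cI v) VE) => E; [left|right] => p; rewrite E => -[].
Qed.

Lemma exists_torus_point V g d : g \is d.-homog -> V = zero_set g ->
  ~ (V `<=` coord_hyperplanes R n) -> exists2 t, torus t & g.@[t] = 0.
Proof.
move=> gd -> /existsNP[p /not_implyP[gp pD]].
have [a pa] := exists_coords p; exists (fun j => a 0 j); last exact: gp.
move=> j; apply/eqP => aj; apply: pD; exists j.
apply/(@vanishes_homog _ 1 _ _ _ pa); first by rewrite dhomogX /= mdeg1.
by rewrite /eval_at mevalXU.
Qed.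

Lemma hypersurface_cone V : irreducible_hypersurface V ->
  ~ (V `<=` coord_hyperplanes R n) ->
  exists g, [/\ torus_hypersurface g, V = zero_set g &
    forall f, vanishing_ideal V f <-> vanishing_on_zeros g f].
Proof.
move=> [[d [g [d0 g0 gd VE]]] irrV] VD.
have IE f : vanishing_ideal V f <-> vanishing_on_zeros g f.
  by rewrite VE; apply: vanishing_ideal_zero_set gd _ => //; rewrite -VE; case: irrV.
exists g; split => //; split => //; first by exists d.
- move=> u v; rewrite -!IE; apply: irreducible_prime => //.
  by rewrite VE; apply: zero_set_closed.
- exact: exists_torus_point gd VE VD.
Qed.

Lemma eq_zero_set f g : (forall t, f.@[t] = 0 <-> g.@[t] = 0) ->
  zero_set f = zero_set g.
Proof.
by move=> H; rewrite predeqE => p; split=> E a /E; rewrite /eval_at H.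
Qed.

Lemma hadamard_product_cone C D g g' h e :
  torus_hypersurface g -> torus_hypersurface g' ->
  C = zero_set g -> D = zero_set g' ->
  (0 < e)%N -> h \is e.-homog -> hadamard_product C D = zero_set h ->
  hadamard_cone g g' h.
Proof.
move=> [_ [d d0 gd] _ [s ts gs]] [_ [d' d'0 g'd] _ [t tt gt]] CE DE e0 he HE.
have Hin a b : eval_at g a = 0 -> eval_at g' b = 0 -> eval_at h (hadamard_row a b) = 0.
  (* An undefined product corresponds to the zero vector, where [h] vanishes since [0 < e]. *)
  move=> ga gb; have [->|ab0] := eqVneq (hadamard_row a b) 0.
    exact: homog_eval0 he.
  have a0 : a != 0.
    by apply: contraNneq ab0 => ->; apply/eqP/rowP => j; rewrite !mxE mul0r.
  have b0 : b != 0.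
    by apply: contraNneq ab0 => ->; apply/eqP/rowP => j; rewrite !mxE mulr0.
  have [p pa] := exists_point a0; have [q qb] := exists_point b0.
  have [r rab] := exists_point ab0.
  apply/(vanishes_homog he rab); rewrite -[vanishes_at h r]/(zero_set h r) -HE.
  move=> V _; apply; exists p, q; split; last by exists a, b.
    by rewrite CE; apply/(vanishes_homog gd pa).
  by rewrite DE; apply/(vanishes_homog g'd qb).
have rowE x y : hadamard_row (\row_j x j) (\row_j y j) = \row_j mulpt x y j.
  by apply/rowP => j; rewrite !mxE.
have h_nonempty : zero_set h !=set0.
  have ab0 : \row_j mulpt s t j != 0.
    apply/eqP => /rowP/(_ ord0)/eqP; rewrite !mxE mulf_eq0.
    by rewrite (negPf (ts _)) (negPf (tt _)).
  have [r rab] := exists_point ab0; exists r; apply/(vanishes_homog he rab).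
  by rewrite -rowE; apply: Hin; rewrite eval_at_row.
move=> u; split=> [hu x y gx gy|Hu].
  apply: hu; rewrite -eval_at_row -rowE.
  by apply: Hin; rewrite eval_at_row.
apply/(vanishing_ideal_zero_set u e0 he h_nonempty) => r.
(* The zero set of [u] is closed, so by definition of the closure only actual products need
   checking. *)
rewrite -HE => /(_ _ (zero_set_closed u)); apply=> {}r [p [q [Cp Dq [a [b [pa qb rab]]]]]].
move=> c /(coords_proportional rab)[k k0 ->].
have -> : k *: hadamard_row a b = hadamard_row (k *: a) b.
  by apply/rowP => j; rewrite !mxE mulrA.
move: Cp Dq; rewrite CE DE => /(_ _ (coordsZ k0 pa)) ga /(_ _ qb) gb.
rewrite -(Hu _ _ ga gb); apply: meval_eq => j; by rewrite mxE.
Qed.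

End ProjectiveCone.

Theorem proposition4p7 (R : realType) (n : nat) (C D : set (proj_space R n))
    (irrC : irreducible_hypersurface C) (irrD : irreducible_hypersurface D)
    (ndC : ~ (C `<=` coord_hyperplanes R n))
    (ndD : ~ (D `<=` coord_hyperplanes R n))
    (hCD : hypersurface (hadamard_product C D)) :
  exists (alpha1 alpha2 beta1 beta2 : R[i]) (I1 I2 : 'X_{1..n.+1}),
    [/\ binomial_hypersurface_of C alpha1 alpha2 I1 I2,
        C = zero_set (binomial alpha1 alpha2 I1 I2),
        binomial_hypersurface_of D beta1 beta2 I1 I2,
        D = zero_set (binomial beta1 beta2 I1 I2)
      & hadamard_product C D =
        zero_set (binomial (alpha1 * beta1) (alpha2 * beta2) I1 I2)].
Proof.
have [g [gH CE IC]] := hypersurface_cone irrC ndC.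
have [g' [g'H DE ID]] := hypersurface_cone irrD ndD.
have [e [h [e0 h0 he HE]]] := hCD.
have Hcone := hadamard_product_cone gH g'H CE DE e0 he HE.
have [I1 [I2 [p [q [[I12 dI tp tq] [genC genD genH]]]]]] :=
  hadamard_cone_binomial gH g'H h0 Hcone.
have zeroE f s : (forall u, vanishing_on_zeros f u <-> exists r, u = r * tbinomial s I1 I2) ->
    zero_set f = zero_set (tbinomial s I1 I2).
  move=> gen; apply: eq_zero_set => t; split.
    by apply: (gen _).2; exists 1; rewrite mul1r.
  by have [r ->] := (gen f).1 (fun a fa => fa); rewrite mevalM => ->; rewrite mulr0.
(* The coefficients of [tbinomial p I1 I2] and [tbinomial q I1 I2]; those at the product point are
   their products. *)
exists (mon p I2), (mon p I1), (mon q I2), (mon q I1), I1, I2; split.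
- split => //; split; rewrite ?mon_neq0 //.
  by rewrite predeqE => f; rewrite IC genC.
- by rewrite CE; apply: zeroE.
- split => //; split; rewrite ?mon_neq0 //.
  by rewrite predeqE => f; rewrite ID genD.
- by rewrite DE; apply: zeroE.
- rewrite HE; apply: eq_zero_set => t.
  by rewrite genH /tbinomial !mon_mulpt.
Qed.
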